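(* Let $i\in\{1,\dots,\ell\}$, let $d=d_{i-1}+1$, $d'=d_i$, and let $F_{i,i}=\mathbb{E}[\bar a_{i-1}\bar a_{i-1}^T\otimes g_i g_i^T]\in\mathbb{R}^{dd'\times dd'}$ be the $i$-th diagonal block of the Fisher information matrix of the network. Then any pair $(\bar A, G)\in\mathbb{R}^{d\times d}\times\mathbb{R}^{d'\times d'}$ which minimizes $$(R,S)\mapsto \|F_{i,i}-R\otimes S\|_F$$ over all $(R,S)\in\mathbb{R}^{d\times d}\times\mathbb{R}^{d'\times d'}$ also minimizes $$(R,S)\mapsto \|\mathcal{Z}(F_{i,i})-\mathrm{vec}(R)\,\mathrm{vec}(S)^T\|_F$$ over all $(R,S)\in\mathbb{R}^{d\times d}\times\mathbb{R}^{d'\times d'}$; that is, it solves the ordinary rank-1 matrix approximation problem for $\mathcal{Z}(F_{i,i})$.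
   Context: Network. Fix an $\ell$-layer feedforward network $f_\theta$ with weight matrices $W_i\in\mathbb{R}^{d_i\times(d_{i-1}+1)}$, $1\le i\le \ell$, and activation functions $\sigma_i$ (applied componentwise, with derivative $\sigma_i'$). For an input $x=:a_0\in\mathbb{R}^{d_0}$ set $\bar a_{i-1}=(1,a_{i-1}^T)^T\in\mathbb{R}^{d_{i-1}+1}$, $s_i=W_i\bar a_{i-1}$, $a_i=\sigma_i(s_i)\in\mathbb{R}^{d_i}$ for $i=1,\dots,\ell$, and $f_\theta(x)=a_\ell$. The loss is $L(y,z)=-\log p(y|z)$, where $p(y|f_\theta(x))=p(y|x,\theta)$ is the density of the predictive distribution $P_{y|x}(\theta)$. For a pair $(x,y)$, the pre-activation derivative $g_i=\nabla_{s_i}L\in\mathbb{R}^{d_i}$ is given by back-propagation: starting from $\mathcal{D}a_\ell=\partial_zL(y,a_\ell)$, for $i$ from $\ell$ down to $1$, $g_i=\mathcal{D}a_i\odot\sigma_i'(s_i)$ ($\odot$ is the componentwise product) and $\mathcal{D}a_{i-1}$ is the gradient of $L$ with respect to $a_{i-1}$, i.e. $W_i^Tg_i$ with the bias component dropped. Thus $\bar a_{i-1}$ and $g_i$ are random vectors when $x\sim Q_x$ (the input distribution) and $y\sim P_{y|x}(\theta)$; $\mathbb{E}$ is the expectation with respect to this joint law, and the entries of $\bar a_{i-1}\bar a_{i-1}^T\otimes g_ig_i^T$ are assumed integrable. Notation. $\otimes$ is the Kronecker product, i.e. $A\otimes B$ is the block matrix with $(\mu,\nu)$ block $A_{\mu,\nu}B$.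 $\|\cdot\|_F$ is the Frobenius norm. $\mathrm{vec}$ vectorizes a matrix by stacking its columns. Zigzag rearrangement $\mathcal{Z}$. For $M\in\mathbb{R}^{d'd\times d'd}$ partitioned into $d\times d$ blocks $M_{\mu,\nu}\in\mathbb{R}^{d'\times d'}$, $1\le\mu,\nu\le d$, the matrix $\mathcal{Z}(M)\in\mathbb{R}^{d^2\times(d')^2}$ has as its rows the vectors $\mathrm{vec}(M_{\mu,\nu})^T$, with the blocks listed in column-wise order: $\mathrm{vec}(M_{1,1})^T,\dots,\mathrm{vec}(M_{d,1})^T,\dots,\mathrm{vec}(M_{1,d})^T,\dots,\mathrm{vec}(M_{d,d})^T$. It is applied to $F_{i,i}$ with $d=d_{i-1}+1$ and $d'=d_i$. *)

(* Defs.v *)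
From HB Require Import structures.
From mathcomp Require Import all_boot all_order all_algebra.
From mathcomp Require Import all_classical all_reals all_analysis.
From mathcomp.real_closed Require Export mxtens.

Set Implicit Arguments.
Unset Strict Implicit.
Unset Printing Implicit Defensive.

Import Order.TTheory GRing.Theory Num.Theory.
Import numFieldNormedType.Exports.

Local Open Scope classical_set_scope.
Local Open Scope ring_scope.

(* R^n as column vectors, with its Borel sigma-algebra. *)
Notation borel_cV R n := (g_sigma_algebraType (@open 'cV[R]_n)).

Section MatrixOperations.
Context {R : realType}.

Definition frobenius_norm {m n : nat} (M : 'M[R]_(m, n)) : R :=
  Num.sqrt (\sum_i \sum_j M i j ^+ 2).

(* mxvec is row-major, hence the inner transpose to stack columns. *)
Definition vec {m n : nat} (A : 'M[R]_(m, n)) : 'cV[R]_(n * m) :=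
  (mxvec A^T)^T.

(* The block with block indices (mu, nu) of a matrix made of d' x d' blocks;
   mxtens_index (mu, r) has value mu * d' + r, as in A *t B. *)
Definition mxblock_at {d d' : nat} (M : 'M[R]_(d * d')) (mu nu : 'I_d) :
    'M[R]_d' :=
  \matrix_(r, s) M (mxtens_index (mu, r)) (mxtens_index (nu, s)).

(* Column-wise listing of the blocks: row number nu * d + mu holds the block
   with block indices (mu, nu). *)
Definition zigzag {d d' : nat} (M : 'M[R]_(d * d')) : 'M[R]_(d * d, d' * d') :=
  \matrix_(k < d * d)
    (vec (mxblock_at M (mxtens_unindex k).2 (mxtens_unindex k).1))^T.

Definition minimizes {T : Type} (F : T -> R) (t : T) : Prop :=
  forall u : T, F t <= F u.

Lemma index_pairs (T1 T2 : eqType) (s1 : seq T1) (s2 : seq T2) x1 x2 :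
    x1 \in s1 -> x2 \in s2 ->
  index (x1, x2) [seq (a, b) | a <- s1, b <- s2]
    = (index x1 s1 * size s2 + index x2 s2)%N.
Proof.
move=> + x2s; elim: s1 => //= a s1 IH; rewrite inE index_cat size_map.
have injp c : injective (fun b : T2 => (c : T1, b)) by move=> u v [].
have [<- _|ax] := eqVneq x1 a.
  by rewrite map_f //= index_map.
move=> /= xs1; case: ifP => [/mapP[b _ [E _]]|_]; first by rewrite E eqxx in ax.
by rewrite IH // mulSn addnA.
Qed.

Lemma mxvec_indexE (m n : nat) (i : 'I_m) (j : 'I_n) :
  mxvec_index i j = mxtens_index (i, j).
Proof.
apply: val_inj => /=; rewrite /enum_rank [enum_rank_in]unlock insubdK; last first.
  by rewrite -[_ \in _]/(_ < _)%N cardE index_mem mem_enum.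
rewrite enumT unlock /= index_pairs ?mem_enum //.
by rewrite size_enum_ord !index_enum_ord.
Qed.

Lemma vecE (m n : nat) (A : 'M[R]_(m, n)) (i : 'I_m) (j : 'I_n) :
  vec A (mxtens_index (j, i)) 0 = A i j.
Proof. by rewrite -mxvec_indexE mxE mxvecE mxE. Qed.

Lemma zigzagE (d d' : nat) (M : 'M[R]_(d * d')) mu nu r s :
  zigzag M (mxtens_index (nu, mu)) (mxtens_index (s, r))
    = M (mxtens_index (mu, r)) (mxtens_index (nu, s)).
Proof. by rewrite mxE mxtens_indexK mxE vecE mxE. Qed.

End MatrixOperations.

(* Layer i >= 1 has d i units and weight matrix weight i; the first column of
   weight i multiplies the bias. Entries at index 0 are never used. At a point
   where an activation is not derivable (the kink of ReLU), dactivation is any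
   convention. *)
Record network (R : realType) (d : nat -> nat) := Network {
  weight : forall i, 'M[R]_(d i, 1 + d i.-1) ;
  activation : nat -> R -> R ;
  dactivation : nat -> R -> R ;
  dactivationP : forall i t, derivable (activation i) t 1 ->
    dactivation i t = 'D_1 (activation i) t }.

Section Network.
Context {R : realType} {d : nat -> nat}.
Variable N : network R d.

Definition add_bias {n : nat} (a : 'cV[R]_n) : 'cV[R]_(1 + n) := col_mx 1 a.

Fixpoint act (x : 'cV[R]_(d 0)) (i : nat) : 'cV[R]_(d i) :=
  match i with
  | 0 => x
  | j.+1 => map_mx (activation N j.+1) (weight N j.+1 *m add_bias (act x j))
  end.

Definition abar (x : 'cV[R]_(d 0)) (i : nat) : 'cV[R]_(1 + d i) :=
  add_bias (act x i).

Definition preact (x : 'cV[R]_(d 0)) (i : nat) : 'cV[R]_(d i) :=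
  weight N i *m abar x i.-1.

Section Backpropagation.
Variables (l : nat) (Y : Type) (p : Y -> 'cV[R]_(d l) -> R).

Definition loss (y : Y) (z : 'cV[R]_(d l)) : R := - ln (p y z).

Definition grad_loss (y : Y) (z : 'cV[R]_(d l)) : 'cV[R]_(d l) :=
  \col_j 'D_(delta_mx j 0) (loss y) z.

(* k is the number of layers above layer i; in the base case i = l, so that
   conform_mx is the identity (see grad_act_last). *)
Fixpoint grad_act_rec (x : 'cV[R]_(d 0)) (y : Y) (k i : nat) : 'cV[R]_(d i) :=
  match k with
  | 0 => conform_mx 0 (grad_loss y (act x l))
  | k'.+1 =>
      dsubmx ((weight N i.+1)^T *m
        map2_mx *%R (grad_act_rec x y k' i.+1)
                    (map_mx (dactivation N i.+1) (preact x i.+1)))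
  end.

Definition grad_act (x : 'cV[R]_(d 0)) (y : Y) (i : nat) : 'cV[R]_(d i) :=
  grad_act_rec x y (l - i) i.

Definition grad_preact (x : 'cV[R]_(d 0)) (y : Y) (i : nat) : 'cV[R]_(d i) :=
  map2_mx *%R (grad_act x y i) (map_mx (dactivation N i) (preact x i)).

Lemma grad_act_last x y : grad_act x y l = grad_loss y (act x l).
Proof. by rewrite /grad_act subnn /= conform_mx_id. Qed.

Lemma grad_act_step x y i : (i < l)%N ->
  grad_act x y i = dsubmx ((weight N i.+1)^T *m grad_preact x y i.+1).
Proof. by move=> il; rewrite /grad_preact /grad_act -(subnSK il). Qed.

End Backpropagation.
End Network.

Section Model.
Context {R : realType} {d : nat -> nat} {l : nat}.
Context {dY : measure_display} {Y : measurableType dY}.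
Variables (N : network R d) (nu : {measure set Y -> \bar R}).
Variable p : Y -> 'cV[R]_(d l) -> R.

Local Notation X := (borel_cV R (d 0)).

(* The measure P_{y|x}(theta) with density p(y | f(x)) with respect to nu. *)
Definition predictive (x : 'cV[R]_(d 0)) (B : set Y) : \bar R :=
  (\int[nu]_(y in B) (p y (act N x l))%:E)%E.

Definition predictive_density : Prop :=
  [/\ measurable_fun setT (fun w : X * Y => p w.2 (act N w.1 l)),
      forall (x : X) y, 0 <= p y (act N x l),
      forall x : X, predictive x setT = 1%E
    & forall (x : X) y, 0 < p y (act N x l) ->
        forall j, derivable (loss p y) (act N x l) (delta_mx j 0)].

(* J is the law of (x, y) when x ~ Qx and y ~ P_{y|x}(theta). *)
Definition joint_law (Qx : probability X R) (J : probability (X * Y)%type R) :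
    Prop :=
  forall (A : set X) (B : set Y), measurable A -> measurable B ->
    J (A `*` B) = (\int[Qx]_(x in A) predictive x B)%E.

Definition fisher_integrand (i : nat) (w : X * Y) :
    'M[R]_((1 + d i.-1) * d i) :=
  let a := abar N w.1 i.-1 in
  let g := grad_preact N p w.1 w.2 i in
  (a *m a^T) *t (g *m g^T).

Definition fisher_block (J : probability (X * Y)%type R) (i : nat) :
    'M[R]_((1 + d i.-1) * d i) :=
  \matrix_(r, c) fine 'E_J[fun w => fisher_integrand i w r c].

End Model.

(* Main.v *)
(* Writing row and column indices as pairs, M has entry M (mu, r) (nu, s) where
   Z(M) has entry ((nu, mu), (s, r)). So Z only permutes the entries of a matrix,
   hence is linear and preserves the Frobenius norm, and it sends R *t S to
   vec R *m (vec S)^T: the two objective functions are equal. *)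

Require Import Defs.
From mathcomp Require Import all_boot all_order all_algebra.
From mathcomp Require Import all_classical all_reals all_analysis.

Set Implicit Arguments.
Unset Strict Implicit.
Unset Printing Implicit Defensive.

Import Order.TTheory GRing.Theory Num.Theory.
Import numFieldNormedType.Exports.

Local Open Scope classical_set_scope.
Local Open Scope ring_scope.

Lemma sum_mxtens_index (V : nmodType) (m n : nat) (f : 'I_(m * n) -> V) :
  \sum_k f k = \sum_i \sum_j f (mxtens_index (i, j)).
Proof.
rewrite pair_big /= (reindex (@mxtens_index m n)) /=.
  by apply: eq_bigr => -[].
by exists (@mxtens_unindex m n) => k _; rewrite (mxtens_indexK, mxtens_unindexK).
Qed.

(** At row [(nu, mu)] and column [(s, r)] both product terms reduce to [A mu nu * B r s], the
    column-major order of [vec] matching the column-wise listing of blocks. *)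
Lemma zigzag_tens_residual (R : realType) (d d' : nat) (M : 'M[R]_(d * d'))
    (A : 'M[R]_d) (B : 'M[R]_d') :
  zigzag (M - A *t B) = zigzag M - vec A *m (vec B)^T.
Proof.
apply/matrixP => k j.
rewrite -(mxtens_unindexK k) -(mxtens_unindexK j).
case: (mxtens_unindex k) (mxtens_unindex j) => [nu mu] [s r].
rewrite zigzagE [LHS]mxE [RHS]mxE zigzagE; congr (_ + _).
rewrite [LHS]mxE tensmxE [RHS]mxE; congr (- _).
by rewrite [RHS]mxE big_ord1 [(vec B)^T _ _]mxE !vecE.
Qed.

Lemma frobenius_norm_zigzag (R : realType) (d d' : nat) (M : 'M[R]_(d * d')) :
  frobenius_norm (zigzag M) = frobenius_norm M.
Proof.
congr Num.sqrt; rewrite !sum_mxtens_index.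
under eq_bigr do under eq_bigr do rewrite sum_mxtens_index.
under [RHS]eq_bigr do under eq_bigr do rewrite sum_mxtens_index.
under eq_bigr do under eq_bigr do under eq_bigr do under eq_bigr do
  rewrite zigzagE.
(* The same squares are summed in the order nu, mu, s, r on the left and mu, r, nu, s on the right;
   three exchanges align them. *)
rewrite exchange_big /=; apply: eq_bigr => mu _.
rewrite [RHS]exchange_big /=; apply: eq_bigr => nu _.
by rewrite exchange_big.
Qed.

Theorem theorem3p1 (R : realType) (l : nat) (d : nat -> nat) (N : network R d)
  (dY : measure_display) (Y : measurableType dY)
  (nu : {sigma_finite_measure set Y -> \bar R})
  (p : Y -> 'cV[R]_(d l) -> R)
  (Qx : probability (borel_cV R (d 0)) R)
  (J : probability (borel_cV R (d 0) * Y)%type R)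
  (hp : predictive_density N nu p)
  (hJ : joint_law N nu p Qx J)
  (i : nat) (hi : (1 <= i <= l)%N)
  (hint : forall r c, J.-integrable setT
     (fun w => (fisher_integrand N p i w r c)%:E))
  (A : 'M[R]_(1 + d i.-1)) (G : 'M[R]_(d i)) :
  let F := fisher_block N p J i in
  minimizes (fun RS : 'M[R]_(1 + d i.-1) * 'M[R]_(d i) =>
    frobenius_norm (F - RS.1 *t RS.2)) (A, G) ->
  minimizes (fun RS : 'M[R]_(1 + d i.-1) * 'M[R]_(d i) =>
    frobenius_norm (zigzag F - vec RS.1 *m (vec RS.2)^T)) (A, G).
Proof.
(* Both sides of the inequality, at [(A, G)] and at [RS], become values of the Kronecker
   objective. *)
move=> F minF RS; rewrite -!zigzag_tens_residual !frobenius_norm_zigzag.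
exact: minF.
Qed.
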